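(* For every $\epsilon>0$ and every finite nonempty set $A\subset\mathbb{H}\setminus\{0\}$, \[ |A+A| \gtrsim_\epsilon \frac{|A|^{14/9-\epsilon}}{d_*(A)^{5/9}}. \]
   Context: $\mathbb{H}$ denotes the quaternions; $A+A=\{a+b:a,b\in A\}$. For finite nonempty $A\subset\mathbb{H}\setminus\{0\}$, $d_*(A)=\min_{t>0}\min_{Q,R}|Q|^2|R|^2/(|A|t^3)$, the inner minimum over finite nonempty $Q,R\subset\mathbb{H}\setminus\{0\}$ with $\max\{|Q|,|R|\}\ge|A|$ and $|Q\cap Rx|\ge t$ for all $x\in A$, where $Rx=\{rx:r\in R\}$. $X\gtrsim_\epsilon Y$ means $X\ge c_\epsilon Y/(\log |A|)^{c}$ for an absolute constant $c$ and a constant $c_\epsilon>0$ depending only on $\epsilon$. *)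

(* Defs.v *)
From Stdlib Require Import Reals List.
Import ListNotations.
Open Scope R_scope.

(* Real quaternions a0 + a1 i + a2 j + a3 k. *)
Record quat := Quat { q0 : R; q1 : R; q2 : R; q3 : R }.

Definition qzero : quat := Quat 0 0 0 0.

Definition qadd (x y : quat) : quat :=
  Quat (q0 x + q0 y) (q1 x + q1 y) (q2 x + q2 y) (q3 x + q3 y).

(* Hamilton product: i^2 = j^2 = k^2 = ijk = -1. *)
Definition qmul (x y : quat) : quat :=
  Quat (q0 x * q0 y - q1 x * q1 y - q2 x * q2 y - q3 x * q3 y)
       (q0 x * q1 y + q1 x * q0 y + q2 x * q3 y - q3 x * q2 y)
       (q0 x * q2 y - q1 x * q3 y + q2 x * q0 y + q3 x * q1 y)
       (q0 x * q3 y + q1 x * q2 y - q2 x * q1 y + q3 x * q0 y).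

Definition quat_eq_dec (x y : quat) : {x = y} + {x <> y}.
Proof.
  destruct x as [a0 a1 a2 a3], y as [b0 b1 b2 b3].
  destruct (Req_EM_T a0 b0); [|right; congruence].
  destruct (Req_EM_T a1 b1); [|right; congruence].
  destruct (Req_EM_T a2 b2); [|right; congruence].
  destruct (Req_EM_T a3 b3); [|right; congruence].
  left; subst; reflexivity.
Defined.

(* A finite nonempty subset of H \ {0}, represented by a duplicate-free list;
   its cardinality is the length of the list. *)
Definition nz_finset (S : list quat) : Prop :=
  NoDup S /\ S <> [] /\ Forall (fun s => s <> qzero) S.

Definition card_sumset (A : list quat) : nat :=
  length (nodup quat_eq_dec (flat_map (fun a => map (fun b => qadd a b) A) A)).

Definition rtrans (Rs : list quat) (x : quat) : list quat :=
  map (fun r => qmul r x) Rs.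

Definition cap_card (Q Rs : list quat) (x : quat) : nat :=
  length (filter (fun q => if in_dec quat_eq_dec q (rtrans Rs x) then true else false) Q).

Definition dstar_admissible (A : list quat) (t : R) (Q Rs : list quat) : Prop :=
  0 < t /\ nz_finset Q /\ nz_finset Rs /\
  (length A <= Nat.max (length Q) (length Rs))%nat /\
  (forall x, In x A -> t <= INR (cap_card Q Rs x)).

Definition dstar_value (A : list quat) (t : R) (Q Rs : list quat) : R :=
  (INR (length Q))^2 * (INR (length Rs))^2 / (INR (length A) * t^3).

Definition is_dstar (A : list quat) (d : R) : Prop :=
  (exists t Q Rs, dstar_admissible A t Q Rs /\ d = dstar_value A t Q Rs) /\
  (forall t Q Rs, dstar_admissible A t Q Rs -> d <= dstar_value A t Q Rs).

(* Main.v *)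
(* Left multiplication r |-> r (s + b) is a similarity of R^4, which makes the
   Solymosi-Tardos proof of the Szemeredi-Trotter theorem for Cartesian products
   available.  If similarities, any two of which agree in at most one point, have
   graphs with at least k points on X x Y, send each point of such a graph to the
   point with the nearest first coordinate.  Since nearest-neighbour balls in R^4
   overlap boundedly, for half of the points the two balls contain O(|X|/k) points
   of X and O(|Y|/k) points of Y; there are O(|X|^2 |Y|^2 / k^2) such pairs of
   points, and a pair determines the similarity.

   If t, Q, R realize d = d_*(A), each representation s + b = a in A gives at least
   t solutions of r (s + b) = q, so this incidence bound gives
   #{s : r_{A-B}(s) >= tau} = O(d |A| |B|^2 / tau^3), and hence third moments of
   r_{A-B} are O(d |A| |B|^2 log |A|).

   With S = A + A, A_s = A ∩ (A - s), the Katz-Koester inclusion A + A_s in S ∩ (S - s),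
   and Hoelder's inequality, E(A)^3 |A|^2 <= E_3(A)^2 E(A, S), while
   E(A) >= |A|^4 / |S| and E(A, S)^2 <= |A| |S| E_3(A, S).  Together these give
   |A|^14 = O((d log |A|)^5 |S|^9); no power |A|^eps is lost. *)
Require Import Defs.
From Stdlib Require Import Reals List Lra Lia Bool ClassicalEpsilon.
Import ListNotations.
Open Scope R_scope.

(** * Sums and injections over lists *)

Definition rsum {X} (l : list X) (f : X -> R) : R :=
  fold_right (fun x acc => f x + acc) 0 l.

Lemma rsum_le {X} (l : list X) (f g : X -> R) :
  (forall x, In x l -> f x <= g x) -> rsum l f <= rsum l g.
Proof.
  induction l as [|x l IH]; intros H; simpl; [lra|].
  pose proof (H x (or_introl eq_refl)).
  pose proof (IH (fun y h => H y (or_intror h))). unfold rsum in *. lra.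
Qed.

Lemma rsum_ext {X} (l : list X) (f g : X -> R) :
  (forall x, In x l -> f x = g x) -> rsum l f = rsum l g.
Proof.
  intros H; apply Rle_antisym; apply rsum_le; intros x Hx; rewrite (H x Hx); lra.
Qed.

Lemma rsum_const {X} (l : list X) (c : R) :
  rsum l (fun _ => c) = INR (length l) * c.
Proof.
  induction l as [|x l IH]; [simpl; lra|].
  cbn [rsum fold_right length]; fold (rsum l (fun _ => c)).
  rewrite S_INR, IH; lra.
Qed.

Lemma rsum_scal {X} (l : list X) (c : R) (f : X -> R) :
  rsum l (fun x => c * f x) = c * rsum l f.
Proof.
  induction l as [|x l IH]; simpl; [lra|].
  unfold rsum in *; rewrite IH; lra.
Qed.

Lemma rsum_nonneg {X} (l : list X) (f : X -> R) :
  (forall x, In x l -> 0 <= f x) -> 0 <= rsum l f.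
Proof.
  intros H. pose proof (rsum_le l (fun _ => 0) f H) as H1.
  rewrite rsum_const in H1; lra.
Qed.

Lemma rsum_swap {X Y} (l : list X) (m : list Y) (f : X -> Y -> R) :
  rsum l (fun x => rsum m (f x)) = rsum m (fun y => rsum l (fun x => f x y)).
Proof.
  induction l as [|x l IH].
  - cbn. rewrite rsum_const; lra.
  - cbn [rsum fold_right]. fold (rsum l (fun x => rsum m (f x))). rewrite IH.
    clear. induction m as [|y m IH]; cbn; [lra|].
    unfold rsum in *; cbn in *. lra.
Qed.

Lemma rsum_filter {X} (p : X -> bool) (l : list X) (f : X -> R) :
  rsum (filter p l) f = rsum l (fun x => if p x then f x else 0).
Proof.
  induction l as [|x l IH]; [reflexivity|].
  simpl. destruct (p x); simpl; unfold rsum in *; rewrite IH; lra.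
Qed.

Lemma INR_length_filter {X} (p : X -> bool) (l : list X) :
  INR (length (filter p l)) = rsum l (fun x => if p x then 1 else 0).
Proof.
  rewrite <- rsum_filter, rsum_const; lra.
Qed.

(** AM-GM in root-free form: z is bounded by the geometric mean of p and q through its square. *)
Lemma sqr_le_prod (z p q : R) : 0 <= p -> 0 <= q -> z^2 <= p * q -> 2 * z <= p + q.
Proof.
  intros Hp Hq H. destruct (Rle_lt_dec (2 * z) (p + q)) as [|Hlt]; [assumption|].
  assert (0 < (2 * z - (p + q)) * (2 * z + (p + q))) by (apply Rmult_lt_0_compat; lra).
  pose proof (pow2_ge_0 (p - q)). lra.
Qed.

Lemma cube_le_prod (z p q r : R) :
  0 <= p -> 0 <= q -> 0 <= r -> z^3 <= p * q * r -> 3 * z <= p + q + r.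
Proof.
  intros Hp Hq Hr H. destruct (Rle_lt_dec (3 * z) (p + q + r)) as [|Hlt]; [assumption|].
  assert (H1 : (p + q + r)^3 < (3 * z)^3).
  { set (s := p + q + r) in *. assert (0 <= s) by (unfold s; lra).
    assert (0 < (3 * z - s) * ((3 * z)^2 + 3 * z * s + s^2)).
    { apply Rmult_lt_0_compat; [lra|]. assert (0 < z) by lra.
      pose proof (pow_lt z 2 ltac:(lra)). pose proof (pow2_ge_0 s).
      assert (0 <= z * s) by (apply Rmult_le_pos; lra). lra. }
    lra. }
  assert (H2 : 27 * (p * q * r) <= (p + q + r)^3).
  { assert (0 <= p * (q - r)^2) by (apply Rmult_le_pos; [lra|apply pow2_ge_0]).
    assert (0 <= q * (p - r)^2) by (apply Rmult_le_pos; [lra|apply pow2_ge_0]).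
    assert (0 <= r * (p - q)^2) by (apply Rmult_le_pos; [lra|apply pow2_ge_0]).
    assert (0 <= (p + q + r) * ((p - q)^2 + (q - r)^2 + (p - r)^2)).
    { apply Rmult_le_pos; [lra|].
      pose proof (pow2_ge_0 (p-q)); pose proof (pow2_ge_0 (q-r)); pose proof (pow2_ge_0 (p-r)); lra. }
    (* (p + q + r)^3 - 27 p q r is three times the sum of the first three products plus half of the
       last one. *)
    nra. }
  lra.
Qed.

Lemma rsum_cauchy {X} (l : list X) (f g : X -> R) :
  (rsum l (fun x => f x * g x))^2 <= rsum l (fun x => f x ^ 2) * rsum l (fun x => g x ^ 2).
Proof.
  induction l as [|x l IH]; [cbn; lra|].
  cbn [rsum fold_right].
  fold (rsum l (fun x => f x * g x)) (rsum l (fun x => f x ^ 2)) (rsum l (fun x => g x ^ 2)).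
  assert (HF : 0 <= rsum l (fun x => f x ^ 2)) by (apply rsum_nonneg; intros; apply pow2_ge_0).
  assert (HG : 0 <= rsum l (fun x => g x ^ 2)) by (apply rsum_nonneg; intros; apply pow2_ge_0).
  set (T := rsum l (fun x => f x * g x)) in *.
  set (F := rsum l (fun x => f x ^ 2)) in *.
  set (G := rsum l (fun x => g x ^ 2)) in *.
  assert (2 * (f x * g x * T) <= f x ^ 2 * G + g x ^ 2 * F).
  { apply sqr_le_prod; try (apply Rmult_le_pos; [apply pow2_ge_0|assumption]).
    replace (f x ^ 2 * G * (g x ^ 2 * F)) with ((f x * g x)^2 * (F * G)) by ring.
    rewrite Rpow_mult_distr. apply Rmult_le_compat_l; [apply pow2_ge_0|assumption]. }
  nra.
Qed.

(** Hoelder with three exponents 3, free of cube roots. By induction: after expanding the cube, the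
    pure terms are covered by the hypotheses, and each of the two mixed terms is bounded by three
    products through AM-GM. *)
Lemma rsum_holder3 {X} (l : list X) (z a b c : X -> R) :
  (forall x, In x l -> 0 <= z x /\ 0 <= a x /\ 0 <= b x /\ 0 <= c x) ->
  (forall x, In x l -> z x ^ 3 <= a x * b x * c x) ->
  (rsum l z)^3 <= rsum l a * rsum l b * rsum l c.
Proof.
  induction l as [|x l IH]; intros H0 H; [cbn; lra|].
  assert (IH' := IH (fun y h => H0 y (or_intror h)) (fun y h => H y (or_intror h))).
  assert (H0' := fun y h => H0 y (or_intror h)).
  assert (Hz : 0 <= rsum l z) by (apply rsum_nonneg; intros; apply H0'; assumption).
  assert (Ha : 0 <= rsum l a) by (apply rsum_nonneg; intros; apply H0'; assumption).
  assert (Hb : 0 <= rsum l b) by (apply rsum_nonneg; intros; apply H0'; assumption).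
  assert (Hc : 0 <= rsum l c) by (apply rsum_nonneg; intros; apply H0'; assumption).
  destruct (H0 x (or_introl eq_refl)) as (z0 & a0 & b0 & c0).
  assert (Hx := H x (or_introl eq_refl)).
  cbn [rsum fold_right]. fold (rsum l z) (rsum l a) (rsum l b) (rsum l c).
  set (Z := rsum l z) in *; set (A := rsum l a) in *; set (B := rsum l b) in *;
  set (C := rsum l c) in *. set (zx := z x) in *; set (ax := a x) in *;
  set (bx := b x) in *; set (cx := c x) in *. clearbody Z A B C zx ax bx cx.
  assert (pz : 0 <= zx^3) by (apply pow_le; assumption).
  assert (pZ : 0 <= Z^3) by (apply pow_le; assumption).
  assert (Hsq : forall u v u' v', 0 <= u -> 0 <= v -> u <= u' -> v <= v' ->
            u * u * v <= u' * u' * v').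
  { intros. apply Rmult_le_compat; try assumption; [apply Rmult_le_pos; assumption|].
    apply Rmult_le_compat; assumption. }
  assert (3 * (zx^2 * Z) <= ax * bx * C + ax * B * cx + A * bx * cx).
  { apply cube_le_prod; repeat apply Rmult_le_pos; try assumption.
    replace ((zx^2 * Z)^3) with ((zx^3 * zx^3) * Z^3) by ring.
    replace (ax * bx * C * (ax * B * cx) * (A * bx * cx))
      with (((ax * bx * cx) * (ax * bx * cx)) * (A * B * C)) by ring.
    apply Hsq; assumption. }
  assert (3 * (zx * Z^2) <= ax * B * C + A * bx * C + A * B * cx).
  { apply cube_le_prod; repeat apply Rmult_le_pos; try assumption.
    replace ((zx * Z^2)^3) with ((Z^3 * Z^3) * zx^3) by ring.
    replace (ax * B * C * (A * bx * C) * (A * B * cx))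
      with (((A * B * C) * (A * B * C)) * (ax * bx * cx)) by ring.
    apply Hsq; assumption. }
  replace ((zx + Z)^3) with (zx^3 + 3 * (zx^2 * Z) + 3 * (zx * Z^2) + Z^3) by ring.
  replace ((ax + A) * (bx + B) * (cx + C)) with
   (ax * bx * cx + (ax * bx * C + ax * B * cx + A * bx * cx)
    + (ax * B * C + A * bx * C + A * B * cx) + A * B * C) by ring.
  lra.
Qed.

(** Disjoint union of the fibres [F x]. Sums of cardinalities become lengths of such lists, so that
    double counting reduces to exhibiting an injection between two of them. *)
Definition dsum {X Y} (l : list X) (F : X -> list Y) : list (X * Y) :=
  flat_map (fun x => map (pair x) (F x)) l.

Lemma in_dsum {X Y} (l : list X) (F : X -> list Y) x y :
  In (x, y) (dsum l F) <-> In x l /\ In y (F x).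
Proof.
  unfold dsum. rewrite in_flat_map. split.
  - intros (x' & Hx & H). apply in_map_iff in H as (y' & E & Hy).
    injection E as -> ->. auto.
  - intros [Hx Hy]. exists x. split; [assumption|]. apply in_map; assumption.
Qed.

Lemma length_dsum {X Y} (l : list X) (F : X -> list Y) :
  INR (length (dsum l F)) = rsum l (fun x => INR (length (F x))).
Proof.
  induction l as [|x l IH]; [reflexivity|].
  cbn. rewrite length_app, length_map, plus_INR. unfold dsum in IH. rewrite IH. reflexivity.
Qed.

Lemma NoDup_dsum {X Y} (l : list X) (F : X -> list Y) :
  NoDup l -> (forall x, In x l -> NoDup (F x)) -> NoDup (dsum l F).
Proof.
  induction l as [|x l IH]; intros Hl HF; [constructor|].
  inversion Hl as [|? ? Hx Hl']; subst. cbn. apply NoDup_app.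
  - apply NoDup_map_NoDup_ForallPairs; [intros ? ? _ _ E; injection E; auto|].
    apply HF; left; reflexivity.
  - apply IH; [assumption|]. intros y Hy; apply HF; right; assumption.
  - intros [x' y] H1 H2. apply in_map_iff in H1 as (y' & E & _). injection E as -> ->.
    apply in_dsum in H2 as [H2 _]. contradiction.
Qed.

Lemma length_le_inj {X Y} (l : list X) (m : list Y) (f : X -> Y) :
  NoDup l -> (forall x, In x l -> In (f x) m) ->
  (forall x y, In x l -> In y l -> f x = f y -> x = y) ->
  (length l <= length m)%nat.
Proof.
  intros Hl Hm Hinj. rewrite <- (length_map f l). apply NoDup_incl_length.
  - apply NoDup_map_NoDup_ForallPairs; [|assumption]. intros x y Hx Hy. apply Hinj; assumption.
  - intros y Hy. apply in_map_iff in Hy as (x & <- & Hx). auto.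
Qed.

Lemma INR_length_le_inj {X Y} (l : list X) (m : list Y) (f : X -> Y) :
  NoDup l -> (forall x, In x l -> In (f x) m) ->
  (forall x y, In x l -> In y l -> f x = f y -> x = y) ->
  INR (length l) <= INR (length m).
Proof. intros; apply le_INR; eapply length_le_inj; eauto. Qed.

Lemma INR_length_prod {X Y} (l : list X) (m : list Y) :
  INR (length (list_prod l m)) = INR (length l) * INR (length m).
Proof. rewrite length_prod, mult_INR; reflexivity. Qed.

Lemma exists_min {X} (f : X -> R) (l : list X) :
  l <> [] -> exists x, In x l /\ forall y, In y l -> f x <= f y.
Proof.
  induction l as [|x l IH]; [congruence|]; intros _.
  destruct l as [|x' l].
  - exists x; split; [left; reflexivity|]. intros y [<-|[]]; lra.
  - destruct IH as (m & Hm & Hmin); [congruence|].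
    destruct (Rle_dec (f x) (f m)) as [Hle|Hle].
    + exists x; split; [left; reflexivity|]. intros y [<-|Hy]; [lra|].
      specialize (Hmin y Hy); lra.
    + exists m; split; [right; assumption|]. intros y [<-|Hy]; [lra|auto].
Qed.

(** * Quaternions *)

Definition qsub (x y : quat) : quat :=
  Quat (q0 x - q0 y) (q1 x - q1 y) (q2 x - q2 y) (q3 x - q3 y).

Definition qnorm2 (x : quat) : R := q0 x ^ 2 + q1 x ^ 2 + q2 x ^ 2 + q3 x ^ 2.

Definition qdist2 (x y : quat) : R := qnorm2 (qsub x y).

(* The junk value at 0 is 0. *)
Definition qinv (x : quat) : quat :=
  Quat (q0 x / qnorm2 x) (- q1 x / qnorm2 x) (- q2 x / qnorm2 x) (- q3 x / qnorm2 x).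

Lemma quat_ext (x y : quat) :
  q0 x = q0 y -> q1 x = q1 y -> q2 x = q2 y -> q3 x = q3 y -> x = y.
Proof. destruct x, y; cbn; intros; subst; reflexivity. Qed.

Lemma quat_inj (x y : quat) :
  x = y -> q0 x = q0 y /\ q1 x = q1 y /\ q2 x = q2 y /\ q3 x = q3 y.
Proof. intros ->; auto. Qed.

Ltac qadditive :=
  repeat match goal with
  | H : @eq quat _ _ |- _ =>
      apply quat_inj in H; cbn [qadd qsub q0 q1 q2 q3] in H;
      destruct H as (? & ? & ? & ?)
  end;
  apply quat_ext; cbn [qadd qsub q0 q1 q2 q3]; lra.

Lemma qnorm2_ge0 (x : quat) : 0 <= qnorm2 x.
Proof.
  unfold qnorm2. pose proof (pow2_ge_0 (q0 x)). pose proof (pow2_ge_0 (q1 x)).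
  pose proof (pow2_ge_0 (q2 x)). pose proof (pow2_ge_0 (q3 x)). lra.
Qed.

Lemma qnorm2_eq0 (x : quat) : qnorm2 x = 0 -> x = qzero.
Proof.
  unfold qnorm2. intros H. pose proof (pow2_ge_0 (q0 x)). pose proof (pow2_ge_0 (q1 x)).
  pose proof (pow2_ge_0 (q2 x)). pose proof (pow2_ge_0 (q3 x)).
  apply quat_ext; cbn; apply Rsqr_0_uniq; unfold Rsqr; lra.
Qed.

Lemma qnorm2_pos (x : quat) : x <> qzero -> 0 < qnorm2 x.
Proof.
  intros H. destruct (qnorm2_ge0 x) as [|E]; [assumption|].
  contradiction H; apply qnorm2_eq0; auto.
Qed.

Lemma qnorm2_mul (x y : quat) : qnorm2 (qmul x y) = qnorm2 x * qnorm2 y.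
Proof. unfold qnorm2; cbn [qmul q0 q1 q2 q3]; ring. Qed.

Lemma qsub_eq0 (x y : quat) : qsub x y = qzero -> x = y.
Proof. unfold qzero; intros H; qadditive. Qed.

Lemma qmul_eq0 (x y : quat) : qmul x y = qzero -> y <> qzero -> x = qzero.
Proof.
  intros H Hy. apply qnorm2_eq0. pose proof (qnorm2_pos y Hy).
  assert (E : qnorm2 x * qnorm2 y = 0).
  { rewrite <- qnorm2_mul, H. unfold qnorm2; cbn; ring. }
  apply Rmult_integral in E as [|]; lra.
Qed.

Lemma qmul_cancel_r (x y z : quat) : z <> qzero -> qmul x z = qmul y z -> x = y.
Proof.
  intros Hz H. apply qsub_eq0, (qmul_eq0 _ z); [|assumption].
  apply quat_inj in H; cbn [qmul q0 q1 q2 q3] in H; destruct H as (? & ? & ? & ?).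
  apply quat_ext; cbn [qmul qsub qzero q0 q1 q2 q3]; lra.
Qed.

Lemma qinv_mulK (x y : quat) : x <> qzero -> qmul (qinv x) (qmul x y) = y.
Proof.
  intros Hx; apply qnorm2_pos in Hx.
  apply quat_ext; cbn [qmul qinv q0 q1 q2 q3]; field_simplify; try lra;
  unfold qnorm2 in *; field; lra.
Qed.

Lemma qinv_inv (x : quat) : x <> qzero -> qinv (qinv x) = x.
Proof.
  intros Hx; apply qnorm2_pos in Hx.
  assert (E : qnorm2 (qinv x) = / qnorm2 x).
  { unfold qnorm2 at 1; cbn [qinv q0 q1 q2 q3].
    transitivity (qnorm2 x / qnorm2 x ^ 2); [unfold qnorm2 at 5|]; field; lra. }
  apply quat_ext; cbn [qinv q0 q1 q2 q3]; change (Quat _ _ _ _) with (qinv x); rewrite E; field; lra.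
Qed.

Lemma qdist2_sym (x y : quat) : qdist2 x y = qdist2 y x.
Proof. unfold qdist2, qnorm2; cbn [qsub q0 q1 q2 q3]; ring. Qed.

Lemma qdist2_pos (x y : quat) : x <> y -> 0 < qdist2 x y.
Proof. intros H; apply qnorm2_pos; intros E; apply H, qsub_eq0, E. Qed.

(** * Bounded overlap of nearest-neighbour balls in R^4 *)

Definition qdot (x y : quat) : R :=
  q0 x * q0 y + q1 x * q1 y + q2 x * q2 y + q3 x * q3 y.

(** The vector from x to z is rescaled to length 2 and [up] rounds its coordinates, which names a
    unit cube of R^4 containing it. Meaningful for z <> x only. *)
Definition direction_cell (x z : quat) : Z * (Z * (Z * Z)) :=
  let s := 2 / sqrt (qdist2 z x) in
  (up (s * (q0 z - q0 x)), (up (s * (q1 z - q1 x)),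
    (up (s * (q2 z - q2 x)), up (s * (q3 z - q3 x))))).

(** The values of [up] on [-2, 2]; [up v] is the integer in (v, v + 1]. *)
Definition cell_coords : list Z := [-1; 0; 1; 2; 3]%Z.

Lemma up_eq_close (a b : R) : up a = up b -> (a - b)^2 < 1.
Proof.
  intros H. destruct (archimed a), (archimed b). rewrite H in *.
  assert (-1 < a - b < 1) by lra. nra.
Qed.

Lemma up_coord (n w : R) : 0 < n -> w^2 <= n -> In (up (2 / sqrt n * w)) cell_coords.
Proof.
  intros Hn Hw. set (v := 2 / sqrt n * w).
  assert (Hs : 0 < sqrt n) by (apply sqrt_lt_R0; assumption).
  assert (Hv : v^2 <= 4).
  { unfold v. replace ((2 / sqrt n * w)^2) with (4 * (w^2 / (sqrt n ^ 2))) by (field; lra).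
    rewrite pow2_sqrt by lra.
    assert (w^2 / n * n = w^2) by (field; lra). nra. }
  assert (-2 <= v <= 2) by nra.
  destruct (archimed v).
  assert ((-2 < up v)%Z) by (apply lt_IZR; lra).
  assert ((up v <= 3)%Z) by (apply le_IZR; lra).
  unfold cell_coords; cbn. lia.
Qed.

(* Two unit vectors in the same cell are at distance < 1, hence at an angle
   < 60 degrees, whereas the hypothesis forces angles of at least 60 degrees. *)
Lemma direction_cell_inj (x z w : quat) :
  z <> x -> w <> x ->
  qdist2 z x <= qdist2 z w -> qdist2 w x <= qdist2 z w ->
  direction_cell x z <> direction_cell x w.
Proof.
  intros Hz Hw H1 H2 E. apply qdist2_pos in Hz, Hw.
  unfold direction_cell in E. injection E as E0 E1 E2 E3.
  apply up_eq_close in E0, E1, E2, E3.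
  set (a := sqrt (qdist2 z x)) in *. set (b := sqrt (qdist2 w x)) in *.
  assert (Ha : 0 < a) by (apply sqrt_lt_R0; assumption).
  assert (Hb : 0 < b) by (apply sqrt_lt_R0; assumption).
  assert (Ea : a^2 = qdist2 z x) by (apply pow2_sqrt; lra).
  assert (Eb : b^2 = qdist2 w x) by (apply pow2_sqrt; lra).
  set (D := qdot (qsub z x) (qsub w x)).
  assert (ED : qdist2 z w = a^2 + b^2 - 2 * D).
  { rewrite Ea, Eb. unfold D, qdist2, qnorm2, qdot; cbn [qsub q0 q1 q2 q3]; ring. }
  (* Sum of the four coordinate estimates: two vectors of length 2 at squared distance below 4, so
     the cosine D / (a b) of their angle exceeds 1/2. *)
  assert (Hsum : (2 / a) ^ 2 * a^2 + (2 / b)^2 * b^2 - 2 * (2 / a) * (2 / b) * D < 4).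
  { rewrite Ea, Eb.
    unfold D, qdist2, qnorm2, qdot; cbn [qsub q0 q1 q2 q3]. lra. }
  assert (Hab : 0 < a * b) by (apply Rmult_lt_0_compat; assumption).
  replace ((2 / a) ^ 2 * a^2 + (2 / b)^2 * b^2 - 2 * (2 / a) * (2 / b) * D)
    with (8 * (1 - D / (a * b))) in Hsum by (field; lra).
  assert (a * b < 2 * D).
  { assert (/2 < D / (a * b)) by lra.
    apply (Rmult_lt_compat_r (a * b)) in H; [|assumption].
    replace (D / (a * b) * (a * b)) with D in H by (field; lra). lra. }
  rewrite ED in H1, H2. rewrite <- Ea in H1. rewrite <- Eb in H2.
  (* Comparing zw with the longer of the two sides gives 2 D <= min(a, b)^2 <= a b, a
     contradiction. *)
  destruct (Rle_lt_dec a b); nra.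
Qed.

(* The 5^4 cells of directions, and the centre itself. *)
Definition kissing_bound : R := 626.

Lemma kissing (x : quat) (W : list quat) :
  NoDup W ->
  (forall z w, In z W -> In w W -> z <> w -> qdist2 z x <= qdist2 z w) ->
  INR (length W) <= kissing_bound.
Proof.
  intros HW H.
  set (cells := list_prod cell_coords (list_prod cell_coords (list_prod cell_coords cell_coords))).
  set (W' := filter (fun z => if quat_eq_dec z x then false else true) W).
  assert (HW' : forall z, In z W' <-> In z W /\ z <> x).
  { intros z. unfold W'. rewrite filter_In. destruct (quat_eq_dec z x); intuition congruence. }
  assert (L1 : (length W' <= length cells)%nat).
  { apply (length_le_inj _ _ (direction_cell x)).
    - apply NoDup_filter; assumption.
    - intros z Hz. apply HW' in Hz as [_ Hz]. apply qdist2_pos in Hz as Hp.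
      unfold cells, direction_cell. rewrite !in_prod_iff.
      assert (E : qdist2 z x = (q0 z - q0 x)^2 + (q1 z - q1 x)^2 + (q2 z - q2 x)^2 + (q3 z - q3 x)^2)
        by reflexivity.
      pose proof (pow2_ge_0 (q0 z - q0 x)). pose proof (pow2_ge_0 (q1 z - q1 x)).
      pose proof (pow2_ge_0 (q2 z - q2 x)). pose proof (pow2_ge_0 (q3 z - q3 x)).
      repeat split; apply up_coord; lra.
    - intros z w Hz Hw E. apply HW' in Hz as [Hz Hzx]. apply HW' in Hw as [Hw Hwx].
      destruct (quat_eq_dec z w) as [|Hne]; [assumption|].
      contradiction (direction_cell_inj x z w Hzx Hwx); auto.
      rewrite (qdist2_sym z w). apply H; auto. }
  (* The centre x may itself belong to W and has no direction; it costs one more point. *)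
  assert (L2 : (length W <= length (x :: W'))%nat).
  { apply NoDup_incl_length; [assumption|]. intros z Hz.
    destruct (quat_eq_dec z x) as [->|Hne]; [left; reflexivity|right; apply HW'; auto]. }
  cbn [length] in L2.
  assert (L3 : length cells = 625%nat) by reflexivity.
  unfold kissing_bound. replace 626 with (INR 626) by (rewrite INR_IZR_INZ; reflexivity).
  apply le_INR. lia.
Qed.

(** * Rich similarities *)

Definition rleb (a b : R) : bool := if Rle_dec a b then true else false.

Lemma rleb_le (a b : R) : rleb a b = true <-> a <= b.
Proof. unfold rleb; destruct (Rle_dec a b); intuition congruence. Qed.

Definition inb (x : quat) (l : list quat) : bool :=
  if in_dec quat_eq_dec x l then true else false.

Lemma inb_in (x : quat) (l : list quat) : inb x l = true <-> In x l.
Proof. unfold inb; destruct (in_dec quat_eq_dec x l); intuition congruence. Qed.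

Definition hits (f : quat -> quat) (X Y : list quat) : list quat :=
  filter (fun x => inb (f x) Y) X.

Lemma in_hits (f : quat -> quat) (X Y : list quat) x :
  In x (hits f X Y) <-> In x X /\ In (f x) Y.
Proof. unfold hits; rewrite filter_In, inb_in; reflexivity. Qed.

Definition ball (X : list quat) (z w : quat) : list quat :=
  filter (fun x => rleb (qdist2 z x) (qdist2 z w)) X.

Lemma in_ball (X : list quat) z w x :
  In x (ball X z w) <-> In x X /\ qdist2 z x <= qdist2 z w.
Proof. unfold ball; rewrite filter_In, rleb_le; reflexivity. Qed.

(** The constant c is the square of the ratio, as [qdist2] is a squared distance. *)
Definition similarity (f : quat -> quat) : Prop :=
  exists c, 0 < c /\ forall x y, qdist2 (f x) (f y) = c * qdist2 x y.

Lemma similarity_inj (f : quat -> quat) x y : similarity f -> f x = f y -> x = y.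
Proof.
  intros (c & Hc & Hf) E. destruct (quat_eq_dec x y) as [|Hne]; [assumption|].
  apply qdist2_pos in Hne. specialize (Hf x y). rewrite E in Hf.
  assert (qdist2 (f y) (f y) = 0) by (unfold qdist2, qnorm2; cbn; ring). nra.
Qed.

(** Count pairs (z, y) by y. A similarity preserves nearest neighbours, so if y lies in the ball
    about f z reaching f (nu z), then y is at least as near to f z as any other point of f(Z). By
    [kissing], each y lies in boundedly many such balls. *)
Lemma nearest_balls_overlap (f nu : quat -> quat) (Z Y : list quat) :
  similarity f -> NoDup Z -> NoDup Y ->
  (forall z w, In z Z -> In w Z -> z <> w -> qdist2 z (nu z) <= qdist2 z w) ->
  rsum Z (fun z => INR (length (ball Y (f z) (f (nu z))))) <= kissing_bound * INR (length Y).
Proof.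
  intros Hf HZ HY Hnu.
  set (F := fun y => filter (fun z => rleb (qdist2 (f z) y) (qdist2 (f z) (f (nu z)))) Z).
  apply Rle_trans with (rsum Y (fun y => INR (length (F y)))).
  - rewrite <- !length_dsum.
    apply (INR_length_le_inj _ _ (fun p => (snd p, fst p))).
    + apply NoDup_dsum; [assumption|]. intros; apply NoDup_filter; assumption.
    + intros [z y] H. apply in_dsum in H as [Hz Hy]. apply in_ball in Hy as [Hy Hd].
      cbn [fst snd]. apply in_dsum. split; [assumption|].
      unfold F. rewrite filter_In, rleb_le. auto.
    + intros [z y] [z' y'] _ _ E. cbn in E. congruence.
  - rewrite <- (Rmult_comm (INR (length Y))), <- rsum_const.
    apply rsum_le. intros y Hy. rewrite <- (length_map f).
    apply (kissing y).
    + apply NoDup_map_NoDup_ForallPairs; [|apply NoDup_filter; assumption].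
      intros a b _ _. apply similarity_inj; assumption.
    + intros a b Ha Hb Hab.
      apply in_map_iff in Ha as (z & <- & Hz). apply in_map_iff in Hb as (w & <- & Hw).
      unfold F in Hz, Hw. rewrite filter_In, rleb_le in Hz, Hw.
      destruct Hz as [Hz Hzd], Hw as [Hw _].
      eapply Rle_trans; [exact Hzd|].
      destruct Hf as (c & Hc & Hf). rewrite !Hf.
      apply Rmult_le_compat_l; [lra|]. apply Hnu; congruence.
Qed.

(** At most a quarter of the points exceed four times the bound m / |Z| on the average; the
    inequality is multiplied out to avoid division by |Z|. *)
Lemma markov {X} (Z : list X) (g : X -> R) (m : R) :
  0 < m -> (forall z, In z Z -> 0 <= g z) -> rsum Z g <= m ->
  4 * INR (length (filter (fun z => negb (rleb (INR (length Z) * g z) (4 * m))) Z))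
    <= INR (length Z).
Proof.
  intros Hm Hg Hs. set (n := INR (length Z)).
  assert (Hn : 0 <= n) by apply pos_INR.
  rewrite INR_length_filter.
  apply Rmult_le_reg_r with m; [assumption|].
  rewrite <- rsum_scal, (Rmult_comm _ m), <- rsum_scal.
  apply Rle_trans with (n * rsum Z g); [|apply Rmult_le_compat_l; assumption].
  rewrite <- rsum_scal. apply rsum_le. intros z Hz. specialize (Hg z Hz).
  assert (0 <= n * g z) by (apply Rmult_le_pos; assumption).
  unfold rleb. destruct (Rle_dec (n * g z) (4 * m)); cbn [negb]; lra.
Qed.

Lemma filter_andb_union {X} (p q : X -> bool) (l : list X) :
  INR (length l) <= INR (length (filter (fun x => p x && q x) l))
    + INR (length (filter (fun x => negb (p x)) l))
    + INR (length (filter (fun x => negb (q x)) l)).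
Proof.
  rewrite <- !plus_INR. apply le_INR.
  induction l as [|x l IH]; [auto|]. cbn.
  destruct (p x), (q x); cbn; lia.
Qed.

(** The threshold is the one that [markov] yields from the overlap bound: the ball holds O(|X| / K)
    points of X. *)
Definition tight (K : R) (X : list quat) (z w : quat) : bool :=
  rleb (K * INR (length (ball X z w))) (4 * (kissing_bound * INR (length X))).

Definition flag_ok (K : R) (f : quat -> quat) (X Y : list quat) (p : quat * quat) : bool :=
  (if quat_eq_dec (fst p) (snd p) then false else true)
  && (inb (f (fst p)) Y && inb (f (snd p)) Y)
  && (tight K X (fst p) (snd p) && tight K Y (f (fst p)) (f (snd p))).

Definition flags (K : R) (f : quat -> quat) (X Y : list quat) : list (quat * quat) :=
  filter (flag_ok K f X Y) (list_prod X X).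

Lemma NoDup_list_prod {A B} (l : list A) (m : list B) :
  NoDup l -> NoDup m -> NoDup (list_prod l m).
Proof.
  intros Hl Hm. assert (E : forall l' : list A, list_prod l' m = dsum l' (fun _ : A => m)).
  { induction l' as [|x l' IH]; cbn; [reflexivity|]. rewrite IH; reflexivity. }
  rewrite E. apply NoDup_dsum; auto.
Qed.

(** Each hit is paired with its nearest other hit. The ball in X fails to be tight for at most a
    quarter of the hits, and so does the ball in Y, which leaves at least half of them. *)
Lemma half_flags (K : R) (f : quat -> quat) (X Y : list quat) :
  similarity f -> NoDup X -> NoDup Y -> 2 <= K -> K <= INR (length (hits f X Y)) ->
  INR (length (hits f X Y)) <= 2 * INR (length (flags K f X Y)).
Proof.
  intros Hf HX HY HK2 HK. set (Z := hits f X Y) in *. set (n := INR (length Z)) in *.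
  assert (HZ : NoDup Z) by (apply NoDup_filter; assumption).
  assert (Hnu : forall z, exists w, In z Z ->
     (In w Z /\ w <> z) /\ forall v, In v Z -> z <> v -> qdist2 z w <= qdist2 z v).
  { intros z. destruct (in_dec quat_eq_dec z Z) as [Hz|]; [|exists z; tauto].
    (* Another hit exists because there are at least K >= 2 of them. *)
    destruct (exists_min (qdist2 z) (remove quat_eq_dec z Z)) as (w & Hw & Hmin).
    - intros E. assert (L : (length Z <= length [z])%nat).
      { apply NoDup_incl_length; [assumption|]. intros v Hv.
        destruct (quat_eq_dec v z) as [->|Hne]; [left; reflexivity|].
        assert (H : In v (remove quat_eq_dec z Z)) by (apply in_in_remove; assumption).
        rewrite E in H; destruct H. }
      apply le_INR in L. change (INR (length [z])) with 1 in L. unfold n in HK. lra.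
    - exists w. intros _. split; [apply in_remove in Hw; tauto|].
      intros v Hv Hne. apply Hmin, in_in_remove; auto. }
  set (nu := fun z => proj1_sig (constructive_indefinite_description _ (Hnu z))).
  assert (Hnu' : forall z, In z Z -> (In (nu z) Z /\ nu z <> z) /\
     forall v, In v Z -> z <> v -> qdist2 z (nu z) <= qdist2 z v)
    by (intros z; exact (proj2_sig (constructive_indefinite_description _ (Hnu z)))).
  clearbody nu. clear Hnu. rename Hnu' into Hnu.
  assert (Hnear : forall z w, In z Z -> In w Z -> z <> w -> qdist2 z (nu z) <= qdist2 z w)
    by (intros z w Hz; apply Hnu; assumption).
  assert (Hpos : 0 < INR (length X) /\ 0 < INR (length Y)).
  { destruct Z as [|z0 Z0] eqn:EZ; [unfold n in HK; cbn in HK; lra|].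
    assert (H : In z0 (hits f X Y)) by (fold Z; rewrite EZ; left; reflexivity).
    apply in_hits in H as [H1 H2].
    split; apply lt_0_INR; [destruct X|destruct Y]; cbn in *; try contradiction; lia. }
  assert (Hkb : 0 < kissing_bound) by (unfold kissing_bound; lra).
  (* The overlap bound serves twice: with the identity for the balls in X, and with f for the balls
     in Y. *)
  assert (BX := nearest_balls_overlap (fun x => x) nu Z X).
  assert (BY := nearest_balls_overlap f nu Z Y Hf HZ HY Hnear).
  specialize (BX ltac:(exists 1; split; [lra|intros; lra]) HZ HX Hnear). cbn beta in BX.
  apply markov in BX; [|apply Rmult_lt_0_compat; tauto|intros; apply pos_INR].
  apply markov in BY; [|apply Rmult_lt_0_compat; tauto|intros; apply pos_INR].
  cbn beta in BX, BY. fold n in BX, BY.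
  set (G := filter (fun z => tight n X z (nu z) && tight n Y (f z) (f (nu z))) Z).
  assert (HG : n <= 2 * INR (length G)).
  { pose proof (filter_andb_union (fun z => tight n X z (nu z))
      (fun z => tight n Y (f z) (f (nu z))) Z) as U. cbn beta in U. fold G n in U.
    unfold tight in U. lra. }
  apply Rle_trans with (1 := HG). apply Rmult_le_compat_l; [lra|].
  apply (INR_length_le_inj _ _ (fun z => (z, nu z))).
  - apply NoDup_filter; assumption.
  - intros z Hz. unfold G in Hz. apply filter_In in Hz as [Hz Ht].
    destruct (Hnu z Hz) as [[Hw Hne] _].
    apply in_hits in Hz as [Hz Hfz]. apply in_hits in Hw as [Hw Hfw].
    unfold flags. apply filter_In. split; [apply in_prod; assumption|].
    unfold flag_ok; cbn [fst snd].
    destruct (quat_eq_dec z (nu z)); [congruence|].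
    rewrite (proj2 (inb_in _ _) Hfz), (proj2 (inb_in _ _) Hfw). cbn [andb].
    apply andb_prop in Ht as [T1 T2]. unfold tight in *. rewrite rleb_le in T1, T2.
    (* Tightness at level n, the number of hits, implies tightness at the lower level K. *)
    apply andb_true_intro. rewrite !rleb_le.
    split; (eapply Rle_trans; [|eassumption]); apply Rmult_le_compat_r; auto using pos_INR.
  - intros z w _ _ E; congruence.
Qed.

Lemma tight_pairs (K : R) (X : list quat) :
  0 < K -> NoDup X ->
  K * INR (length (filter (fun p => tight K X (fst p) (snd p)) (list_prod X X)))
    <= 4 * kissing_bound * INR (length X) ^ 2.
Proof.
  intros HK HX. set (F := fun z => filter (fun w => tight K X z w) X).
  apply Rle_trans with (K * INR (length (dsum X F))).
  - apply Rmult_le_compat_l; [lra|]. apply (INR_length_le_inj _ _ (fun p => p)); auto.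
    + apply NoDup_filter, NoDup_list_prod; assumption.
    + intros [z w] H. apply filter_In in H as [H1 H2]. apply in_prod_iff in H1 as [Hz Hw].
      apply in_dsum. split; [assumption|]. apply filter_In; auto.
  - rewrite length_dsum, <- rsum_scal.
    replace (4 * kissing_bound * INR (length X) ^ 2)
      with (INR (length X) * (4 * (kissing_bound * INR (length X)))) by ring.
    rewrite <- rsum_const. apply rsum_le. intros z Hz.
    destruct (F z) as [|w0 W] eqn:E.
    { cbn. unfold kissing_bound. pose proof (pos_INR (length X)). lra. }
    rewrite <- E.
    (* All tight partners of [z] lie in the ball reaching the farthest of them. *)
    destruct (exists_min (fun w => - qdist2 z w) (F z)) as (w & Hw & Hmax); [congruence|].
    assert (Hw' := Hw). unfold F in Hw'. apply filter_In in Hw' as [_ Ht].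
    apply rleb_le in Ht. eapply Rle_trans; [|exact Ht].
    apply Rmult_le_compat_l; [lra|]. apply le_INR, NoDup_incl_length.
    + apply NoDup_filter; assumption.
    + intros v Hv. apply in_ball. specialize (Hmax v Hv). cbn beta in Hmax.
      apply filter_In in Hv as [Hv _]. split; [assumption|lra].
Qed.

(** The map is determined by two points of its graph, so all flags of all maps inject into pairs
    made of a tight pair in X and a tight pair in Y. The constant is 2 * 4^2: half of the hits are
    lost, and each side contributes a factor 4 from [tight]. *)
Lemma rich_sum {T} (L : list T) (f : T -> quat -> quat) (X Y : list quat) (K : R) :
  NoDup L -> NoDup X -> NoDup Y -> 2 <= K ->
  (forall l, In l L -> similarity (f l)) ->
  (forall l m x y, In l L -> In m L -> x <> y -> f l x = f m x -> f l y = f m y -> l = m) ->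
  (forall l, In l L -> K <= INR (length (hits (f l) X Y))) ->
  K^2 * rsum L (fun l => INR (length (hits (f l) X Y)))
    <= 32 * kissing_bound^2 * (INR (length X) * INR (length Y))^2.
Proof.
  intros HL HX HY HK Hsim Hdet Hrich.
  set (GX := filter (fun p => tight K X (fst p) (snd p)) (list_prod X X)).
  set (GY := filter (fun p => tight K Y (fst p) (snd p)) (list_prod Y Y)).
  assert (H1 : rsum L (fun l => INR (length (hits (f l) X Y)))
     <= 2 * (INR (length GX) * INR (length GY))).
  { apply Rle_trans with (rsum L (fun l => 2 * INR (length (flags K (f l) X Y)))).
    - apply rsum_le. intros l Hl. apply half_flags; auto.
    - rewrite rsum_scal. apply Rmult_le_compat_l; [lra|].
      rewrite <- length_dsum, <- INR_length_prod.
      apply (INR_length_le_inj _ _ (fun q => (snd q, (f (fst q) (fst (snd q)), f (fst q) (snd (snd q)))))).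
      + apply NoDup_dsum; [assumption|]. intros; apply NoDup_filter, NoDup_list_prod; assumption.
      + intros [l [x y]] H. apply in_dsum in H as [Hl H]. apply filter_In in H as [Hxy H].
        unfold flag_ok in H; cbn [fst snd] in *.
        apply andb_prop in H as [H Ht]. apply andb_prop in H as [_ H].
        apply andb_prop in H as [Hx Hy]. apply andb_prop in Ht as [TX TY].
        apply inb_in in Hx, Hy.
        apply in_prod; apply filter_In; split; auto. apply in_prod; assumption.
      + intros [l [x y]] [m [x' y']] Hl Hm E.
        apply in_dsum in Hl as [Hl Hf]. apply in_dsum in Hm as [Hm _].
        cbn [fst snd] in E. injection E as <- <- Ex Ey.
        f_equal. apply (Hdet l m x y); auto.
        apply filter_In in Hf as [_ Hf]. unfold flag_ok in Hf; cbn [fst snd] in Hf.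
        destruct (quat_eq_dec x y); [discriminate|assumption]. }
  assert (HGX := tight_pairs K X ltac:(lra) HX). fold GX in HGX.
  assert (HGY := tight_pairs K Y ltac:(lra) HY). fold GY in HGY.
  assert (H2 : (K * INR (length GX)) * (K * INR (length GY)) <=
     (4 * kissing_bound * INR (length X) ^ 2) * (4 * kissing_bound * INR (length Y) ^ 2)).
  { apply Rmult_le_compat; try assumption; apply Rmult_le_pos; auto using pos_INR; lra. }
  apply (Rmult_le_compat_l (K^2)) in H1; [|apply pow2_ge_0]. lra.
Qed.

(** * Level sets of the representation function *)

Lemma rsum_app {X} (l m : list X) (f : X -> R) : rsum (l ++ m) f = rsum l f + rsum m f.
Proof. unfold rsum. induction l as [|x l IH]; cbn; [lra|]. rewrite IH; lra. Qed.

Lemma rsum_map {X Y} (g : X -> Y) (l : list X) (f : Y -> R) :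
  rsum (map g l) f = rsum l (fun x => f (g x)).
Proof. unfold rsum. induction l as [|x l IH]; cbn; [reflexivity|]. rewrite IH; lra. Qed.

Lemma rsum_dsum {X Y} (l : list X) (F : X -> list Y) (f : X * Y -> R) :
  rsum (dsum l F) f = rsum l (fun x => rsum (F x) (fun y => f (x, y))).
Proof.
  induction l as [|x l IH]; [reflexivity|].
  unfold dsum in *. cbn [flat_map]. rewrite rsum_app, rsum_map, IH. reflexivity.
Qed.

Lemma NoDup_hits (f : quat -> quat) (X Y : list quat) : NoDup X -> NoDup (hits f X Y).
Proof. apply NoDup_filter. Qed.

(** For fixed s, the maps with fewer than K = g / (2 |M|) hits account for at most half of g, so the
    K-rich maps still carry g / 2 and [rich_sum] applies to them. The hypothesis 4 |M| <= g is what
    makes K >= 2. *)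
Lemma rich_family (S M : list quat) (f : quat * quat -> quat -> quat) (X Y : list quat) (g : R) :
  NoDup S -> NoDup M -> NoDup X -> NoDup Y ->
  (forall s m, In s S -> In m M -> similarity (f (s, m))) ->
  (forall s m s' m' x y, In s S -> In m M -> In s' S -> In m' M -> x <> y ->
     f (s, m) x = f (s', m') x -> f (s, m) y = f (s', m') y -> (s, m) = (s', m')) ->
  0 < INR (length M) -> 4 * INR (length M) <= g ->
  (forall s, In s S -> g <= rsum M (fun m => INR (length (hits (f (s, m)) X Y)))) ->
  INR (length S) * g ^ 3
    <= 256 * kissing_bound ^ 2 * (INR (length M) * (INR (length X) * INR (length Y)))^2.
Proof.
  intros HS HM HX HY Hsim Hdet HM0 Hg4 Hg.
  set (mu := INR (length M)) in *. set (K := g / (2 * mu)).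
  assert (HK : 2 * mu * K = g) by (unfold K; field; lra).
  assert (HK2 : 2 <= K) by nra.
  set (i := fun l => INR (length (hits (f l) X Y))).
  set (L := dsum S (fun s => filter (fun m => rleb K (i (s, m))) M)).
  assert (HL : forall s m, In (s, m) L -> In s S /\ In m M /\ K <= i (s, m)).
  { intros s m H. apply in_dsum in H as [H1 H2]. rewrite filter_In, rleb_le in H2. tauto. }
  assert (HR : K^2 * rsum L i <= 32 * kissing_bound^2 * (INR (length X) * INR (length Y))^2).
  { apply rich_sum; try assumption.
    - apply NoDup_dsum; [assumption|]. intros; apply NoDup_filter; assumption.
    - intros [s m] H. apply HL in H. apply Hsim; tauto.
    - intros [s m] [s' m'] x y H H'. apply HL in H, H'. apply Hdet; tauto.
    - intros [s m] H. apply HL in H. tauto. }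
  assert (HLS : INR (length S) * (g / 2) <= rsum L i).
  { unfold L. rewrite rsum_dsum, <- rsum_const. apply rsum_le. intros s Hs.
    rewrite rsum_filter. specialize (Hg s Hs).
    assert (H : rsum M (fun m => i (s, m)) + -1 * (mu * K)
       <= rsum M (fun m => if rleb K (i (s, m)) then i (s, m) else 0)); [|fold i in Hg; unfold i in *; lra].
    unfold mu. rewrite <- rsum_const, <- rsum_scal.
    assert (A : forall u v w : quat -> R, (forall m, In m M -> u m + v m <= w m) ->
       rsum M u + rsum M v <= rsum M w).
    { clear. intros u v w H. induction M as [|m M IH]; cbn; [lra|].
      pose proof (H m (or_introl eq_refl)). pose proof (IH (fun x h => H x (or_intror h))).
      unfold rsum in *; lra. }
    apply A. intros m _. unfold rleb. destruct (Rle_dec K (i (s, m))); lra. }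
  apply (Rmult_le_compat_l (K^2)) in HLS; [|apply pow2_ge_0].
  assert (H := Rle_trans _ _ _ HLS HR).
  apply (Rmult_le_compat_l (8 * mu^2)) in H; [|pose proof (pow2_ge_0 mu); lra].
  replace (INR (length S) * g^3) with (8 * mu^2 * (K^2 * (INR (length S) * (g/2))))
    by (rewrite <- HK; field).
  eapply Rle_trans; [exact H|]. apply Req_le. ring.
Qed.

(** * Similarities from quaternion multiplication *)

Lemma qmul_similarity_l (r s : quat) : r <> qzero -> similarity (fun b => qmul r (qadd s b)).
Proof.
  intros Hr. exists (qnorm2 r). split; [apply qnorm2_pos; assumption|].
  intros x y. unfold qdist2. rewrite <- qnorm2_mul. f_equal.
  apply quat_ext; cbn; ring.
Qed.

Lemma qmul_similarity_r (q s : quat) : q <> qzero -> similarity (fun x => qsub (qmul x q) s).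
Proof.
  intros Hr. exists (qnorm2 q). split; [apply qnorm2_pos; assumption|].
  intros x y. unfold qdist2. rewrite Rmult_comm, <- qnorm2_mul. f_equal.
  apply quat_ext; cbn; ring.
Qed.

(** Subtracting the two equations eliminates the translation and leaves r (x - y) = r' (x - y),
    where x - y can be cancelled. [qmul_l_det] does the same with the multiplier on the other
    side. *)
Lemma qmul_r_det (r r' s s' x y : quat) :
  r <> qzero -> x <> y ->
  qmul r (qadd s x) = qmul r' (qadd s' x) ->
  qmul r (qadd s y) = qmul r' (qadd s' y) -> (s, r) = (s', r').
Proof.
  intros Hr Hxy Ex Ey.
  assert (E : qmul r (qsub x y) = qmul r' (qsub x y)).
  { assert (D : forall u v, qmul u (qsub x y) = qsub (qmul u (qadd v x)) (qmul u (qadd v y)))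
      by (intros; apply quat_ext; cbn; ring).
    rewrite (D r s), (D r' s'), Ex, Ey. reflexivity. }
  apply qmul_cancel_r in E; [|intros H; apply Hxy, qsub_eq0, H]. subst r'.
  apply (f_equal (qmul (qinv r))) in Ex. rewrite !qinv_mulK in Ex by assumption.
  f_equal. qadditive.
Qed.

Lemma qmul_l_det (q q' s s' x y : quat) :
  x <> y ->
  qsub (qmul x q) s = qsub (qmul x q') s' ->
  qsub (qmul y q) s = qsub (qmul y q') s' -> (s, q) = (s', q').
Proof.
  intros Hxy Ex Ey.
  assert (E : qmul (qsub x y) q = qmul (qsub x y) q').
  { assert (D : forall u v, qmul (qsub x y) u = qsub (qsub (qmul x u) v) (qsub (qmul y u) v))
      by (intros; apply quat_ext; cbn; ring).
    rewrite (D q s), (D q' s'), Ex, Ey. reflexivity. }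
  apply (f_equal (qmul (qinv (qsub x y)))) in E.
  rewrite !qinv_mulK in E by (intros H; apply Hxy, qsub_eq0, H). subst q'.
  f_equal. qadditive.
Qed.

Definition cap (Q Rs : list quat) (x : quat) : list quat :=
  filter (fun q => inb q (rtrans Rs x)) Q.

Lemma cap_cardE Q Rs x : cap_card Q Rs x = length (cap Q Rs x).
Proof. reflexivity. Qed.

Lemma in_cap Q Rs x q : In q (cap Q Rs x) <-> In q Q /\ exists r, In r Rs /\ q = qmul r x.
Proof.
  unfold cap. rewrite filter_In, inb_in. unfold rtrans. rewrite in_map_iff.
  split; intros [H (r & H1 & H2)]; split; auto; exists r; auto.
Qed.

Lemma length_cap_le Q Rs x : NoDup Q ->
  (length (cap Q Rs x) <= length Q)%nat /\ (length (cap Q Rs x) <= length Rs)%nat.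
Proof.
  intros HQ. split; [apply filter_length_le|].
  rewrite <- (length_map (fun r => qmul r x) Rs). apply NoDup_incl_length.
  - apply NoDup_filter; assumption.
  - intros q Hq. apply filter_In in Hq as [_ Hq]. apply inb_in, Hq.
Qed.

Lemma rsum_hits_le (S B A : list quat) :
  NoDup S -> NoDup B ->
  rsum S (fun s => INR (length (hits (qadd s) B A))) <= INR (length A) * INR (length B).
Proof.
  intros HS HB. rewrite <- length_dsum, <- INR_length_prod.
  apply (INR_length_le_inj _ _ (fun p => (qadd (fst p) (snd p), snd p))).
  - apply NoDup_dsum; auto using NoDup_hits.
  - intros [s b] H. apply in_dsum in H as [_ H]. apply in_hits in H as [H1 H2].
    apply in_prod; assumption.
  - intros [s b] [s' b'] _ _ E. cbn [fst snd] in E.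
    apply pair_equal_spec in E as [E ->]. f_equal. qadditive.
Qed.

Lemma nz_finset_neq0 (V : list quat) v : nz_finset V -> In v V -> v <> qzero.
Proof. intros (_ & _ & H) Hv. rewrite Forall_forall in H. auto. Qed.

Lemma INR_length_ge1 (V : list quat) : V <> [] -> 1 <= INR (length V).
Proof.
  intros H. change 1 with (INR 1). apply le_INR. destruct V; [congruence|cbn; lia].
Qed.

Section LevelSet.
Context (A B S Q Rs : list quat) (t tau : R).
Hypotheses (HA : nz_finset A) (HB : NoDup B) (HB0 : B <> []) (HS : NoDup S)
  (HQ : nz_finset Q) (HR : nz_finset Rs) (Ht : 0 < t) (Htau : 0 < tau)
  (Hcap : forall x, In x A -> t <= INR (cap_card Q Rs x))
  (Hrep : forall s, In s S -> tau <= INR (length (hits (qadd s) B A))).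

(** There are at least tau choices of b with s + b in A, and for each of them at least t elements q
    of Q of the form r (s + b). *)
Lemma many_triples s : In s S ->
  tau * t <= INR (length (dsum (hits (qadd s) B A) (fun b => cap Q Rs (qadd s b)))).
Proof.
  intros Hs. rewrite length_dsum.
  apply Rle_trans with (INR (length (hits (qadd s) B A)) * t).
  - apply Rmult_le_compat_r; [lra|auto].
  - rewrite <- rsum_const. apply rsum_le. intros b Hb. apply in_hits in Hb as [_ Hb].
    rewrite <- cap_cardE. auto.
Qed.

Lemma NoDup_triples s :
  NoDup (dsum (hits (qadd s) B A) (fun b => cap Q Rs (qadd s b))).
Proof.
  apply NoDup_dsum; [apply NoDup_hits; assumption|]. intros. apply NoDup_filter, HQ.
Qed.

Lemma in_triples s b q :
  In (b, q) (dsum (hits (qadd s) B A) (fun b => cap Q Rs (qadd s b))) ->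
  In b B /\ qadd s b <> qzero /\ In q Q /\ exists r, In r Rs /\ q = qmul r (qadd s b).
Proof.
  intros H. apply in_dsum in H as [H1 H2]. apply in_hits in H1 as [H1 H3].
  apply in_cap in H2. split; [assumption|]. split; [|assumption].
  apply (nz_finset_neq0 A); assumption.
Qed.

(** The solutions of r (s + b) = q are read as hits of the maps b |-> r (s + b) from B to Q, with r
    in Rs as parameter. *)
Lemma level_set_rich_R : 4 * INR (length Rs) <= tau * t ->
  INR (length S) * (tau * t) ^ 3
    <= 256 * kissing_bound ^ 2 * (INR (length Rs) * (INR (length B) * INR (length Q)))^2.
Proof.
  intros H4.
  apply (rich_family S Rs (fun p b => qmul (snd p) (qadd (fst p) b)));
    try apply HQ; try apply HR; try assumption.
  - intros s r _ Hr. apply qmul_similarity_l, (nz_finset_neq0 Rs); assumption.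
  - intros s r s' r' x y _ Hr _ _. cbn [fst snd]. apply qmul_r_det, (nz_finset_neq0 Rs); assumption.
  - pose proof (INR_length_ge1 Rs (proj1 (proj2 HR))). lra.
  - intros s Hs. eapply Rle_trans; [apply many_triples; exact Hs|].
    rewrite <- length_dsum. cbn [fst snd].
    set (phi := fun p : quat * quat =>
      (qinv (qmul (qadd s (fst p)) (qinv (snd p))), fst p)).
    (* [r] is recovered from q = r (s + b) as ((s + b) q^-1)^-1. *)
    assert (Hphi : forall b q, In (b, q) (dsum (hits (qadd s) B A) (fun b => cap Q Rs (qadd s b))) ->
       exists r, In r Rs /\ q = qmul r (qadd s b) /\ phi (b, q) = (r, b)).
    { intros b q H. apply in_triples in H as (Hb & Ha & Hq & r & Hr & E).
      exists r; split; [assumption|]. split; [assumption|]. unfold phi; cbn [fst snd].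
      f_equal. rewrite <- (qinv_inv r) by (apply (nz_finset_neq0 Rs); assumption).
      f_equal. apply (qmul_cancel_r _ _ q); [apply (nz_finset_neq0 Q); assumption|].
      rewrite E at 3. rewrite qinv_mulK by (apply (nz_finset_neq0 Rs); assumption).
      apply nz_finset_neq0 in Hq; [|exact HQ]. apply qnorm2_pos in Hq.
      apply quat_ext; unfold qnorm2 in Hq; cbn [qmul qinv qadd q0 q1 q2 q3]; unfold qnorm2; field; lra. }
    apply (INR_length_le_inj _ _ phi); [apply NoDup_triples| |].
    + intros [b q] H. destruct (Hphi _ _ H) as (r & Hr & E & ->).
      apply in_triples in H as (Hb & _ & Hq & _).
      apply in_dsum. split; [assumption|]. apply in_hits. rewrite <- E. auto.
    + intros [b q] [b' q'] H H' E.
      destruct (Hphi _ _ H) as (r & Hr & E1 & E2). destruct (Hphi _ _ H') as (r' & Hr' & E1' & E2').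
      rewrite E2, E2' in E. injection E as -> ->. congruence.
Qed.

(** The same equation, solved as r^-1 q - s = b: hits of the maps x |-> x q - s from the inverses of
    Rs to B, with q in Q as parameter. *)
Lemma level_set_rich_Q : 4 * INR (length Q) <= tau * t ->
  INR (length S) * (tau * t) ^ 3
    <= 256 * kissing_bound ^ 2 * (INR (length Q) * (INR (length Rs) * INR (length B)))^2.
Proof.
  intros H4. rewrite <- (length_map qinv Rs).
  apply (rich_family S Q (fun p x => qsub (qmul x (snd p)) (fst p)));
    try apply HQ; try assumption.
  - apply NoDup_map_NoDup_ForallPairs; [|apply HR]. intros r r' Hr Hr' E.
    apply (f_equal qinv) in E.
    rewrite !qinv_inv in E by (apply (nz_finset_neq0 Rs); assumption). assumption.
  - intros s q _ Hq. apply qmul_similarity_r, (nz_finset_neq0 Q); assumption.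
  - intros s q s' q' x y _ _ _ _. cbn [fst snd]. apply qmul_l_det.
  - pose proof (INR_length_ge1 Q (proj1 (proj2 HQ))). lra.
  - intros s Hs. eapply Rle_trans; [apply many_triples; exact Hs|].
    rewrite <- length_dsum. cbn [fst snd].
    set (phi := fun p : quat * quat => (snd p, qmul (qadd s (fst p)) (qinv (snd p)))).
    assert (Hphi : forall b q, In (b, q) (dsum (hits (qadd s) B A) (fun b => cap Q Rs (qadd s b))) ->
       In (snd (phi (b, q))) (map qinv Rs) /\ qmul (snd (phi (b, q))) q = qadd s b).
    { intros b q H. apply in_triples in H as (Hb & Ha & Hq & r & Hr & E).
      apply nz_finset_neq0 in Hq as Hq0; [|exact HQ].
      assert (E' : qmul (snd (phi (b, q))) q = qadd s b).
      { unfold phi; cbn [fst snd]. clear E. apply qnorm2_pos in Hq0.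
        apply quat_ext; unfold qnorm2 in Hq0; cbn [qmul qinv qadd q0 q1 q2 q3]; unfold qnorm2; field; lra. }
      split; [|exact E'].
      replace (snd (phi (b, q))) with (qinv r); [apply in_map; assumption|].
      apply (qmul_cancel_r _ _ q); [assumption|]. rewrite E', E.
      apply qinv_mulK, (nz_finset_neq0 Rs); assumption. }
    apply (INR_length_le_inj _ _ phi); [apply NoDup_triples| |].
    + intros [b q] H. destruct (Hphi _ _ H) as (Hr & E).
      apply in_triples in H as (Hb & _ & Hq & _).
      change (phi (b, q)) with (q, snd (phi (b, q))).
      apply in_dsum. split; [assumption|]. apply in_hits. rewrite E. split; [assumption|].
      replace (qsub (qadd s b) s) with b by qadditive. assumption.
    + intros [b q] [b' q'] H H' E.
      destruct (Hphi _ _ H) as (_ & E1). destruct (Hphi _ _ H') as (_ & E1').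
      rewrite E in E1. assert (q = q') by exact (f_equal fst E). subst q'.
      rewrite E1 in E1'. f_equal. qadditive.
Qed.

(** The family is indexed by the smaller of Q and Rs, of size m. If tau t >= 4 m, incidences give
    the bound. Otherwise tau t is so small that the trivial count |S| tau <= |A| |B| suffices,
    because |A| is at most the size n of the larger set. *)
Lemma level_set :
  (length A <= Nat.max (length Q) (length Rs))%nat ->
  INR (length S) * (tau * t) ^ 3
    <= 256 * kissing_bound ^ 2 * (INR (length Q) * INR (length Rs) * INR (length B))^2.
Proof.
  intros Hmax.
  assert (HB1 := INR_length_ge1 B HB0).
  assert (Htt : 0 < tau * t) by (apply Rmult_lt_0_compat; assumption).
  assert (Htriv : INR (length S) * tau <= INR (length A) * INR (length B)).
  { rewrite <- rsum_const. eapply Rle_trans; [apply rsum_le; exact Hrep|].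
    apply rsum_hits_le; assumption. }
  assert (HtQR : t <= INR (length Q) /\ t <= INR (length Rs)).
  { destruct A as [|a A'] eqn:EA; [destruct HA as (_ & H & _); congruence|].
    pose proof (Hcap a (or_introl eq_refl)) as H. rewrite cap_cardE in H.
    destruct (length_cap_le Q Rs a (proj1 HQ)) as [H1 H2]. apply le_INR in H1, H2. lra. }
  assert (HA0 := pos_INR (length A)).
  assert (Hsmall : forall m n, 0 <= m -> t <= n -> INR (length A) <= n -> tau * t <= 4 * m ->
     INR (length S) * (tau * t)^3 <= 256 * kissing_bound^2 * (n * m * INR (length B))^2).
  { intros m n Hm Hn HAn Hlt.
    apply Rle_trans with (16 * (n * m * INR (length B))^2).
    2:{ apply Rmult_le_compat_r; [apply pow2_ge_0|unfold kissing_bound; lra]. }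
    (* The three factors are bounded by |A| |B| <= n |B|, by t <= n <= n |B|, and by (4 m)^2. *)
    replace (INR (length S) * (tau * t)^3) with ((INR (length S) * tau) * t * (tau * t)^2) by ring.
    apply Rle_trans with (INR (length A) * INR (length B) * t * (4 * m)^2).
    { apply Rmult_le_compat.
      - apply Rmult_le_pos; [apply Rmult_le_pos; [apply pos_INR|lra]|lra].
      - apply pow2_ge_0.
      - apply Rmult_le_compat_r; lra.
      - apply pow_incr; lra. }
    replace (16 * (n * m * INR (length B))^2) with
      (n * INR (length B) * (n * INR (length B)) * (4 * m)^2) by ring.
    apply Rmult_le_compat_r; [apply pow2_ge_0|].
    apply Rmult_le_compat; try lra.
    - apply Rmult_le_pos; lra.
    - apply Rmult_le_compat_r; lra.
    - nra. }
  destruct (Nat.max_spec (length Q) (length Rs)) as [[_ E]|[_ E]]; rewrite E in Hmax;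
    apply le_INR in Hmax.
  - destruct (Rle_lt_dec (4 * INR (length Q)) (tau * t)) as [H|H].
    + rewrite (Rmult_assoc (INR (length Q))). apply level_set_rich_Q; assumption.
    + rewrite (Rmult_comm (INR (length Q)) (INR (length Rs))). apply Hsmall; lra.
  - destruct (Rle_lt_dec (4 * INR (length Rs)) (tau * t)) as [H|H].
    + replace (INR (length Q) * INR (length Rs) * INR (length B))
        with (INR (length Rs) * (INR (length B) * INR (length Q))) by ring.
      apply level_set_rich_R; assumption.
    + apply Hsmall; lra.
Qed.
End LevelSet.

(** * Energies *)

(** n^3 - (n - 1)^3 <= 3 n^2. The range runs up to a common N so that the sum over j can later be
    exchanged with the sum over s. *)
Lemma cube_le_sum_squares (n N : nat) : (n <= N)%nat ->
  INR n ^ 3 <= rsum (seq 1 N) (fun j => if (j <=? n)%nat then 3 * INR j ^ 2 else 0).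
Proof.
  intros H. replace N with (n + (N - n))%nat by lia. rewrite seq_app, rsum_app.
  assert (H2 : 0 <= rsum (seq (1 + n) (N - n)) (fun j => if (j <=? n)%nat then 3 * INR j ^ 2 else 0)).
  { apply rsum_nonneg. intros j _. pose proof (pow2_ge_0 (INR j)).
    destruct (j <=? n)%nat; lra. }
  rewrite (rsum_ext (seq 1 n) _ (fun j => 3 * INR j ^ 2)).
  2:{ intros j Hj. apply in_seq in Hj. rewrite (proj2 (Nat.leb_le j n)) by lia. reflexivity. }
  assert (H1 : INR n ^ 3 <= rsum (seq 1 n) (fun j => 3 * INR j ^ 2)); [|lra].
  clear. induction n as [|n IH]; [cbn; lra|].
  rewrite seq_S, rsum_app. unfold rsum at 2; cbn [fold_right plus]. rewrite S_INR.
  pose proof (pos_INR n). nra.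
Qed.

Lemma ln_le (x y : R) : 0 < x -> x <= y -> ln x <= ln y.
Proof. intros Hx [H|<-]; [left; apply ln_increasing; assumption|right; reflexivity]. Qed.

Lemma harmonic_le (n : nat) : (1 <= n)%nat ->
  rsum (seq 1 n) (fun j => / INR j) <= 1 + ln (INR n).
Proof.
  intros H. induction n as [|n IH]; [lia|].
  destruct n as [|n]; [cbn; rewrite ln_1; lra|].
  rewrite seq_S, rsum_app. unfold rsum at 2; cbn [fold_right plus].
  specialize (IH ltac:(lia)). set (m := S n) in *.
  assert (Hm : 1 <= INR m) by (change 1 with (INR 1); apply le_INR; unfold m; lia).
  rewrite S_INR.
  (* This is 1 + x <= exp x at x = -1 / (m + 1). *)
  assert (Hln : ln (INR m / (INR m + 1)) <= - / (INR m + 1)).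
  { rewrite <- (ln_exp (- / (INR m + 1))). apply ln_le.
    - apply Rdiv_lt_0_compat; lra.
    - eapply Rle_trans; [|apply exp_ineq1_le]. apply Req_le. field; lra. }
  unfold Rdiv in Hln. rewrite ln_mult, ln_Rinv in Hln; try lra.
  apply Rinv_0_lt_compat; lra.
Qed.

Definition level_const : R := 256 * kissing_bound ^ 2.

(** For the t, Q, R attaining d, the product |Q|^2 |R|^2 equals d |A| t^3, and t^3 cancels from the
    level set bound. *)
Lemma dstar_level_set (A B S : list quat) (d tau : R) :
  nz_finset A -> is_dstar A d -> NoDup B -> B <> [] -> NoDup S -> 0 < tau ->
  (forall s, In s S -> tau <= INR (length (hits (qadd s) B A))) ->
  INR (length S) * tau ^ 3 <= level_const * (d * INR (length A) * INR (length B) ^ 2).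
Proof.
  intros HA [(t & Q & Rs & (Ht & HQ & HR & Hmax & Hcap) & Ed) _] HB HB0 HS Htau Hrep.
  assert (H := level_set A B S Q Rs t tau HA HB HB0 HS HQ HR Ht Htau Hcap Hrep Hmax).
  assert (Ha := INR_length_ge1 A (proj1 (proj2 HA))).
  assert (Ht3 : 0 < t^3) by (apply pow_lt; assumption).
  assert (E : (INR (length Q) * INR (length Rs))^2 = d * INR (length A) * t^3).
  { rewrite Ed. unfold dstar_value. field. lra. }
  apply Rmult_le_reg_r with (t^3); [assumption|].
  replace (INR (length S) * tau^3 * t^3) with (INR (length S) * (tau * t)^3) by ring.
  eapply Rle_trans; [exact H|]. apply Req_le.
  rewrite Rpow_mult_distr, E. unfold level_const. ring.
Qed.

Lemma dstar_pos (A : list quat) (d : R) : nz_finset A -> is_dstar A d -> 0 < d.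
Proof.
  intros HA [(t & Q & Rs & (Ht & HQ & HR & _) & ->) _]. unfold dstar_value.
  pose proof (INR_length_ge1 A (proj1 (proj2 HA))).
  pose proof (INR_length_ge1 Q (proj1 (proj2 HQ))).
  pose proof (INR_length_ge1 Rs (proj1 (proj2 HR))).
  apply Rdiv_lt_0_compat; apply Rmult_lt_0_compat; try apply pow_lt; lra.
Qed.

(** Layer-cake summation: the level set at height j contributes 3 j^2 * M / j^3 = 3 M / j. The
    heights stop at |A|, so the harmonic sum costs one logarithm. *)
Lemma energy3_le (A B S : list quat) (d : R) :
  nz_finset A -> is_dstar A d -> NoDup B -> B <> [] -> NoDup S ->
  rsum S (fun s => INR (length (hits (qadd s) B A)) ^ 3)
    <= 3 * level_const * d * (1 + ln (INR (length A))) * INR (length A) * INR (length B) ^ 2.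
Proof.
  intros HA Hd HB HB0 HS.
  set (r := fun s => length (hits (qadd s) B A)). set (N := length A).
  assert (Hr : forall s, (r s <= N)%nat).
  { intros s. apply (length_le_inj _ _ (qadd s)).
    - apply NoDup_hits; assumption.
    - intros b Hb. apply in_hits in Hb; tauto.
    - intros b b' _ _ E. qadditive. }
  set (M := level_const * (d * INR N * INR (length B) ^ 2)).
  apply Rle_trans with (rsum (seq 1 N) (fun j => 3 * M * / INR j)).
  - eapply Rle_trans.
    { apply rsum_le. intros s _. apply (cube_le_sum_squares (r s) N (Hr s)). }
    rewrite rsum_swap. apply rsum_le. intros j Hj. apply in_seq in Hj.
    assert (Hj1 : 1 <= INR j) by (change 1 with (INR 1); apply le_INR; lia).
    rewrite <- (rsum_filter (fun s => (j <=? r s)%nat) S (fun _ => 3 * INR j ^ 2)), rsum_const.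
    assert (H := dstar_level_set A B (filter (fun s => (j <=? r s)%nat) S) d (INR j)
      HA Hd HB HB0 (NoDup_filter _ HS) ltac:(lra)).
    fold N M in H. specialize (H ltac:(intros s Hs; apply filter_In in Hs as [_ Hs];
      apply le_INR, Nat.leb_le, Hs)).
    apply Rmult_le_reg_r with (INR j); [lra|].
    replace (3 * M * / INR j * INR j) with (3 * M) by (field; lra). lra.
  - rewrite rsum_scal.
    assert (HM : 0 <= 3 * M).
    { pose proof (dstar_pos A d HA Hd). unfold M, level_const, kissing_bound.
      repeat apply Rmult_le_pos; try apply pow_le; try apply pos_INR; lra. }
    assert (H := harmonic_le N). eapply Rle_trans; [apply Rmult_le_compat_l; [exact HM|apply H]|].
    + destruct HA as (_ & HA0 & _). unfold N. destruct A; [congruence|cbn; lia].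
    + apply Req_le. unfold M. ring.
Qed.

(** * Additive energies of A and of its sumset *)

Definition sums (A : list quat) : list quat :=
  nodup quat_eq_dec (flat_map (fun a => map (fun b => qadd a b) A) A).

Definition diffs (U V : list quat) : list quat :=
  nodup quat_eq_dec (map (fun p => qsub (fst p) (snd p)) (list_prod U V)).

Lemma in_sums (A : list quat) a b : In a A -> In b A -> In (qadd a b) (sums A).
Proof.
  intros Ha Hb. apply nodup_In, in_flat_map. exists a; split; [assumption|].
  apply in_map; assumption.
Qed.

Lemma in_diffs (U V : list quat) a b : In a U -> In b V -> In (qsub a b) (diffs U V).
Proof.
  intros Ha Hb. apply nodup_In, in_map_iff. exists (a, b). split; [reflexivity|].
  apply in_prod; assumption.
Qed.

Section Energy.
Context (A : list quat) (HA : NoDup A).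
Let S := sums A.
Let D := diffs A A.
(** [r w] is A ∩ (A - w), whose size is the number of representations of w in A - A; [u s] is S ∩ (S
    - s). [m y] and [c s y] collect the second summands b in y = a + b with a in A and b in A,
    respectively b in [r s]. *)
Let r (w : quat) := hits (qadd w) A A.
Let u (s : quat) := hits (qadd s) S S.
Let m (y : quat) := hits (qsub y) A A.
Let c (s y : quat) := hits (qsub y) (r s) A.

Local Lemma NoDup_S : NoDup S. Proof. apply NoDup_nodup. Qed.
Local Lemma NoDup_D : NoDup D. Proof. apply NoDup_nodup. Qed.

Local Ltac pairs :=
  cbn [fst snd] in *;
  repeat match goal with
  | H : (_, _) = (_, _) |- _ => apply pair_equal_spec in H; destruct H
  end; repeat apply f_equal2; qadditive.

Local Ltac use e := match goal with |- In ?x _ => replace x with e by qadditive end.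

(** Cauchy-Schwarz over the representations of sums, followed by the rearrangement of a + b = a' +
    b' into a - a' = b' - b. *)
Lemma energy_ge :
  INR (length A) ^ 4 <= INR (length S) * rsum D (fun w => INR (length (r w)) ^ 2).
Proof.
  assert (H1 : INR (length A) * INR (length A) <= rsum S (fun y => INR (length (m y)))).
  { rewrite <- INR_length_prod, <- length_dsum.
    apply (INR_length_le_inj _ _ (fun p => (qadd (fst p) (snd p), snd p))).
    - apply NoDup_list_prod; assumption.
    - intros [a b] H. apply in_prod_iff in H as [Ha Hb]. apply in_dsum. cbn [fst snd].
      split; [apply in_sums; assumption|]. apply in_hits; split; [assumption|]. use a. assumption.
    - intros [a b] [a' b'] _ _ E. pairs. }
  assert (H2 : rsum S (fun y => INR (length (m y)) ^ 2) <= rsum D (fun w => INR (length (r w)) ^ 2)).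
  { rewrite (rsum_ext S _ (fun y => INR (length (list_prod (m y) (m y)))))
      by (intros; rewrite INR_length_prod; ring).
    rewrite (rsum_ext D _ (fun w => INR (length (list_prod (r w) (r w)))))
      by (intros; rewrite INR_length_prod; ring).
    rewrite <- !length_dsum.
    apply (INR_length_le_inj _ _ (fun p => (qsub (snd (snd p)) (fst (snd p)),
      (fst (snd p), qsub (fst p) (snd (snd p)))))).
    - apply NoDup_dsum; [exact NoDup_S|]. intros; apply NoDup_list_prod; apply NoDup_hits; assumption.
    - intros [y [b b']] H. apply in_dsum in H as [Hy H]. apply in_prod_iff in H as [Hb Hb'].
      apply in_hits in Hb as [Hb Hyb]. apply in_hits in Hb' as [Hb' Hyb']. cbn [fst snd].
      apply in_dsum. split; [apply in_diffs; assumption|].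
      apply in_prod; apply in_hits; (split; [assumption|]).
      + use b'. assumption.
      + use (qsub y b). assumption.
    - intros [y [b b']] [y' [e e']] _ _ E. pairs. }
  assert (H3 := rsum_cauchy S (fun y => INR (length (m y))) (fun _ => 1)).
  rewrite (rsum_ext S _ (fun y => INR (length (m y)))) in H3 by (intros; ring).
  rewrite (rsum_const S (1 ^ 2)) in H3.
  assert (H4 : (INR (length A) * INR (length A)) ^ 2 <= rsum S (fun y => INR (length (m y))) ^ 2).
  { apply pow_incr. split; [apply Rmult_le_pos; apply pos_INR|assumption]. }
  apply (Rmult_le_compat_l (INR (length S))) in H2; [|apply pos_INR]. lra.
Qed.

(* Katz-Koester: A + A_s is contained in S_s, where X_s = X ∩ (X - s). *)
Lemma katz_koester s :
  (INR (length A) * INR (length (r s))) ^ 2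
    <= INR (length (u s)) * rsum (u s) (fun y => INR (length (c s y)) ^ 2).
Proof.
  assert (H1 : INR (length A) * INR (length (r s)) <= rsum (u s) (fun y => INR (length (c s y)))).
  { rewrite <- INR_length_prod, <- length_dsum.
    apply (INR_length_le_inj _ _ (fun p => (qadd (fst p) (snd p), snd p))).
    - apply NoDup_list_prod; [|apply NoDup_hits]; assumption.
    - intros [a b] H. apply in_prod_iff in H as [Ha Hb]. cbn [fst snd].
      assert (Hb' := Hb). apply in_hits in Hb' as [Hb1 Hb2].
      apply in_dsum. split; apply in_hits; split; [apply in_sums; assumption| |assumption|].
      + use (qadd a (qadd s b)). apply in_sums; assumption.
      + use a. assumption.
    - intros [a b] [a' b'] _ _ E. pairs. }
  assert (H3 := rsum_cauchy (u s) (fun y => INR (length (c s y))) (fun _ => 1)).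
  rewrite (rsum_ext (u s) _ (fun y => INR (length (c s y)))) in H3 by (intros; ring).
  rewrite (rsum_const (u s) (1 ^ 2)) in H3.
  assert (H4 : (INR (length A) * INR (length (r s))) ^ 2
      <= rsum (u s) (fun y => INR (length (c s y))) ^ 2).
  { apply pow_incr. split; [apply Rmult_le_pos; apply pos_INR|assumption]. }
  lra.
Qed.

(** A term on the left is y = a + b = a' + b' with b, b' in [r s]. The pairs (b, b'), (s + b, s +
    b') and (a', a) in A all have difference w = b' - b, and together they determine s, y, b and
    b'. *)
Lemma fibre_energy_le :
  rsum D (fun s => rsum (u s) (fun y => INR (length (c s y)) ^ 2))
    <= rsum D (fun w => INR (length (r w)) ^ 3).
Proof.
  rewrite (rsum_ext D _ (fun s => INR (length (dsum (u s) (fun y => list_prod (c s y) (c s y)))))).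
  2:{ intros s _. rewrite length_dsum. apply rsum_ext. intros; rewrite INR_length_prod; ring. }
  rewrite (rsum_ext D (fun w => INR (length (r w)) ^ 3)
    (fun w => INR (length (list_prod (r w) (list_prod (r w) (r w))))))
    by (intros; rewrite !INR_length_prod; ring).
  rewrite <- !length_dsum.
  apply (INR_length_le_inj _ _ (fun p => let s := fst p in let y := fst (snd p) in
    let b := fst (snd (snd p)) in let b' := snd (snd (snd p)) in
    (qsub b' b, (b, (qadd s b, qsub y b'))))).
  - apply NoDup_dsum; [exact NoDup_D|]. intros. apply NoDup_dsum.
    + apply NoDup_hits, NoDup_S.
    + intros; apply NoDup_list_prod; apply NoDup_hits, NoDup_hits; assumption.
  - intros [s [y [b b']]] H. apply in_dsum in H as [Hs H]. apply in_dsum in H as [Hy H].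
    apply in_prod_iff in H as [Hb Hb'].
    apply in_hits in Hb as [Hb Hyb]. apply in_hits in Hb as [Hb Hsb].
    apply in_hits in Hb' as [Hb' Hyb']. apply in_hits in Hb' as [Hb' Hsb'].
    cbn [fst snd]. apply in_dsum. split; [apply in_diffs; assumption|].
    repeat apply in_prod; apply in_hits; (split; [assumption|]).
    + use b'. assumption.
    + use (qadd s b'). assumption.
    + use (qsub y b). assumption.
  - intros [s [y [b b']]] [s' [y' [e e']]] _ _ E. pairs.
Qed.

(** If b and s + b lie in A while x and s + x lie in S, then b - x = (s + b) - (s + x) gives two
    representations of one element of A - S. *)
Lemma mixed_energy_le :
  rsum D (fun s => INR (length (r s)) * INR (length (u s)))
    <= rsum (diffs A S) (fun v => INR (length (hits (qadd v) S A)) ^ 2).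
Proof.
  rewrite (rsum_ext D _ (fun s => INR (length (list_prod (r s) (u s)))))
    by (intros; rewrite INR_length_prod; ring).
  rewrite (rsum_ext (diffs A S) _ (fun v => INR (length (list_prod (hits (qadd v) S A) (hits (qadd v) S A)))))
    by (intros; rewrite INR_length_prod; ring).
  rewrite <- !length_dsum.
  apply (INR_length_le_inj _ _ (fun p => let s := fst p in let b := fst (snd p) in
    let x := snd (snd p) in (qsub b x, (x, qadd s x)))).
  - apply NoDup_dsum; [exact NoDup_D|]. intros. apply NoDup_list_prod; apply NoDup_hits;
    [assumption|exact NoDup_S].
  - intros [s [b x]] H. apply in_dsum in H as [Hs H]. apply in_prod_iff in H as [Hb Hx].
    apply in_hits in Hb as [Hb Hsb]. apply in_hits in Hx as [Hx Hsx]. cbn [fst snd].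
    apply in_dsum. split; [apply in_diffs; assumption|].
    apply in_prod; apply in_hits; (split; [assumption|]).
    + use b. assumption.
    + use (qadd s b). assumption.
  - intros [s [b x]] [s' [b' x']] _ _ E. pairs.
Qed.

(** Cauchy-Schwarz with q^2 = q^(1/2) q^(3/2); the sum of q is at most |A| |S|. *)
Lemma mixed_energy_sqr_le :
  (rsum (diffs A S) (fun v => INR (length (hits (qadd v) S A)) ^ 2)) ^ 2
    <= INR (length A) * INR (length S)
       * rsum (diffs A S) (fun v => INR (length (hits (qadd v) S A)) ^ 3).
Proof.
  set (q := fun v => INR (length (hits (qadd v) S A))).
  assert (Hq : forall v, 0 <= q v) by (intros; apply pos_INR).
  assert (H := rsum_cauchy (diffs A S) (fun v => sqrt (q v)) (fun v => q v * sqrt (q v))).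
  rewrite (rsum_ext _ (fun v => sqrt (q v) * (q v * sqrt (q v))) (fun v => q v ^ 2)) in H.
  2:{ intros v _. pose proof (pow2_sqrt (q v) (Hq v)) as Es.
      transitivity (q v * sqrt (q v) ^ 2); [ring|rewrite Es; ring]. }
  rewrite (rsum_ext _ (fun v => sqrt (q v) ^ 2) q) in H by (intros; apply pow2_sqrt, Hq).
  rewrite (rsum_ext _ (fun v => (q v * sqrt (q v))^2) (fun v => q v ^ 3)) in H.
  2:{ intros v _. rewrite Rpow_mult_distr, pow2_sqrt by apply Hq. ring. }
  eapply Rle_trans; [exact H|]. apply Rmult_le_compat_r.
  - apply rsum_nonneg. intros; apply pow_le, Hq.
  - apply rsum_hits_le; [apply NoDup_nodup|exact NoDup_S].
Qed.

(* [r^2] is the geometric mean of [w], [r u] and [r^3], up to the factor [|A|^2]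
   of Katz-Koester, whence Hoelder with three equal exponents. *)
Lemma energy_cube_le :
  INR (length A) ^ 2 * (rsum D (fun w => INR (length (r w)) ^ 2)) ^ 3
    <= rsum D (fun s => rsum (u s) (fun y => INR (length (c s y)) ^ 2))
       * rsum D (fun s => INR (length (r s)) * INR (length (u s)))
       * rsum D (fun w => INR (length (r w)) ^ 3).
Proof.
  (* The empty set is treated apart, since the argument divides by |A|^2. *)
  destruct (Req_dec (INR (length A)) 0) as [E|Hne].
  { rewrite E. rewrite pow_ne_zero by discriminate. rewrite Rmult_0_l.
    repeat apply Rmult_le_pos; apply rsum_nonneg; intros.
    - apply rsum_nonneg; intros; apply pow2_ge_0.
    - apply Rmult_le_pos; apply pos_INR.
    - apply pow_le, pos_INR. }
  set (a := INR (length A)) in *.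
  assert (Ha : 0 < a) by (pose proof (pos_INR (length A)); unfold a in *; lra).
  assert (Ha2 : 0 < a^2) by (apply pow_lt; assumption).
  assert (Hi : 0 < / a^2) by (apply Rinv_0_lt_compat; assumption).
  set (w := fun s => rsum (u s) (fun y => INR (length (c s y)) ^ 2)).
  assert (Hw : forall s, 0 <= w s) by (intros; apply rsum_nonneg; intros; apply pow2_ge_0).
  assert (H := rsum_holder3 D (fun s => INR (length (r s)) ^ 2) (fun s => / a^2 * w s)
    (fun s => INR (length (r s)) * INR (length (u s))) (fun s => INR (length (r s)) ^ 3)).
  rewrite rsum_scal in H.
  apply Rmult_le_reg_l with (/ a^2); [assumption|].
  rewrite <- !Rmult_assoc, Rinv_l, Rmult_1_l by lra.
  apply H.
  - intros s _. repeat split; [apply pow2_ge_0| | |apply pow_le, pos_INR];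
    apply Rmult_le_pos; auto using pos_INR; lra.
  - intros s _. assert (K := katz_koester s). fold a (w s) in K.
    set (rs := INR (length (r s))) in *.
    assert (Hrs : 0 <= rs) by apply pos_INR.
    (* The weight rs^4 / a^2 turns Katz-Koester into the pointwise Hoelder hypothesis (rs^2)^3 <= (w
       / a^2) (rs u) rs^3. *)
    apply (Rmult_le_compat_l (/ a^2 * rs^4)) in K.
    2:{ apply Rmult_le_pos; [lra|apply pow_le; assumption]. }
    replace (/ a^2 * rs^4 * (a * rs)^2) with ((rs^2)^3) in K by (field; lra). lra.
Qed.
End Energy.

(** * Combination of the energy inequalities *)

Lemma sumset_pow_le (A : list quat) (d : R) :
  nz_finset A -> is_dstar A d ->
  INR (length A) ^ 14 <=
    (3 * level_const * d * (1 + ln (INR (length A)))) ^ 5 * INR (card_sumset A) ^ 9.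
Proof.
  intros HA Hd. change (card_sumset A) with (length (sums A)).
  assert (HA1 := INR_length_ge1 A (proj1 (proj2 HA))).
  assert (HS : NoDup (sums A)) by apply NoDup_nodup.
  assert (HD : forall U V, NoDup (diffs U V)) by (intros; apply NoDup_nodup).
  assert (HS0 : sums A <> []).
  { destruct HA as (_ & H & _). destruct A as [|a A']; [congruence|].
    assert (Ha : In a (a :: A')) by (left; reflexivity).
    pose proof (in_sums _ a a Ha Ha) as H1. intros E. rewrite E in H1. exact H1. }
  assert (HS1 := INR_length_ge1 _ HS0).
  assert (HF := energy3_le A A (diffs A A) d HA Hd (proj1 HA) (proj1 (proj2 HA)) (HD _ _)).
  assert (HG := energy3_le A (sums A) (diffs A (sums A)) d HA Hd HS HS0 (HD _ _)).
  assert (H1 := energy_ge A (proj1 HA)).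
  assert (H2 := energy_cube_le A (proj1 HA)).
  assert (H3 := fibre_energy_le A (proj1 HA)).
  assert (H4 := mixed_energy_le A (proj1 HA)).
  assert (H5 := mixed_energy_sqr_le A).
  assert (P0 : 0 <= 3 * level_const * d * (1 + ln (INR (length A)))).
  { pose proof (dstar_pos A d HA Hd).
    assert (0 <= ln (INR (length A))) by (rewrite <- ln_1; apply ln_le; lra).
    unfold level_const, kissing_bound. repeat apply Rmult_le_pos; lra. }
  set (P := 3 * level_const * d * (1 + ln (INR (length A)))) in *.
  set (a := INR (length A)) in *. set (s := INR (length (sums A))) in *.
  set (E := rsum (diffs A A) (fun w => INR (length (hits (qadd w) A A)) ^ 2)) in *.
  set (F := rsum (diffs A A) (fun w => INR (length (hits (qadd w) A A)) ^ 3)) in *.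
  set (W := rsum (diffs A A) _) in H2, H3.
  set (V := rsum (diffs A A) _) in H2, H4.
  set (E' := rsum (diffs A (sums A)) _) in H4, H5.
  set (G := rsum (diffs A (sums A)) _) in HG, H5.
  assert (E0 : 0 <= E) by (apply rsum_nonneg; intros; apply pow2_ge_0).
  assert (F0 : 0 <= F) by (apply rsum_nonneg; intros; apply pow_le, pos_INR).
  assert (W0 : 0 <= W) by (apply rsum_nonneg; intros; apply rsum_nonneg; intros; apply pow2_ge_0).
  assert (V0 : 0 <= V) by (apply rsum_nonneg; intros; apply Rmult_le_pos; apply pos_INR).
  clearbody P a s E F W V E' G.
  assert (K1 : a^2 * E^3 <= F * V * F).
  { eapply Rle_trans; [exact H2|]. repeat apply Rmult_le_compat_r; assumption. }
  assert (K2 : V^2 <= a * s * (P * a * s^2)).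
  { apply Rle_trans with (E'^2); [apply pow_incr; auto|].
    eapply Rle_trans; [exact H5|]. apply Rmult_le_compat_l; [apply Rmult_le_pos; lra|assumption]. }
  assert (K3 : (a^2 * E^3)^2 <= (P * a * a^2)^4 * (a * s * (P * a * s^2))).
  { apply Rle_trans with ((F * V * F)^2).
    - apply pow_incr; split; [|assumption]. apply Rmult_le_pos; apply pow_le; lra.
    - replace ((F * V * F)^2) with (F^4 * V^2) by ring.
      apply Rmult_le_compat; try apply pow_le; try assumption. apply pow_incr; auto. }
  assert (K4 : (a^4)^6 <= s^6 * E^6).
  { rewrite <- Rpow_mult_distr. apply pow_incr; split; [apply pow_le; lra|assumption]. }
  (* After multiplication by a^14 the chain is a^28 <= a^4 s^6 E^6 = s^6 (a^2 E^3)^2 <= s^6 * P^5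
     a^14 s^3. *)
  apply Rmult_le_reg_l with (a^14); [apply pow_lt; lra|].
  apply Rle_trans with (a^4 * (s^6 * E^6)).
  - replace (a^14 * a^14) with (a^4 * (a^4)^6) by ring.
    apply Rmult_le_compat_l; [apply pow_le; lra|assumption].
  - replace (a^4 * (s^6 * E^6)) with (s^6 * (a^2 * E^3)^2) by ring.
    replace (a^14 * (P^5 * s^9)) with (s^6 * ((P * a * a^2)^4 * (a * s * (P * a * s^2)))) by ring.
    apply Rmult_le_compat_l; [apply pow_le; lra|assumption].
Qed.

(** Ninth roots of [sumset_pow_le] give the exponents 14/9 and 5/9, the latter for d and the
    logarithm alike. The logarithm is cut off below at 1 because ln |A| vanishes when |A| = 1. *)
Theorem theorem3p7 :
  exists c : R, 0 <= c /\
  forall eps : R, 0 < eps ->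
  exists ceps : R, 0 < ceps /\
  forall (A : list quat) (d : R),
    nz_finset A -> is_dstar A d ->
    INR (card_sumset A) * Rpower (Rmax 1 (ln (INR (length A)))) c
      >= ceps * Rpower (INR (length A)) (14/9 - eps) / Rpower d (5/9).
Proof.
  exists (5/9). split; [lra|]. intros eps Heps.
  (* 6 = 3 * 2, from 1 + ln a <= 2 l. *)
  set (K := 6 * level_const).
  assert (HK : 0 < K) by (unfold K, level_const, kissing_bound; lra).
  exists (Rpower K (- (5/9))). split; [apply exp_pos|]. intros A d HA Hd.
  assert (H := sumset_pow_le A d HA Hd).
  assert (Hd0 := dstar_pos A d HA Hd).
  assert (Ha := INR_length_ge1 A (proj1 (proj2 HA))).
  set (a := INR (length A)) in *. set (s := INR (card_sumset A)) in *.
  set (l := Rmax 1 (ln a)).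
  assert (Hl : 1 <= l /\ ln a <= l) by (split; [apply Rmax_l|apply Rmax_r]).
  assert (Hlna : 0 <= ln a) by (rewrite <- ln_1; apply ln_le; lra).
  assert (Hlc : 0 < level_const) by (unfold level_const, kissing_bound; lra).
  assert (HP : 0 <= 3 * level_const * d * (1 + ln a) <= K * d * l).
  { assert (0 < level_const * d) by (apply Rmult_lt_0_compat; assumption).
    unfold K. split; nra. }
  assert (HKd : 0 < K * d) by (apply Rmult_lt_0_compat; assumption).
  assert (Hs : 0 < s).
  { destruct (pos_INR (card_sumset A)) as [|E]; [assumption|]. exfalso.
    unfold s in H. rewrite <- E, pow_ne_zero, Rmult_0_r in H by discriminate.
    pose proof (pow_lt a 14 ltac:(lra)). lra. }
  assert (H14 : a^14 <= (K * d * l)^5 * s^9).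
  { eapply Rle_trans; [exact H|]. apply Rmult_le_compat_r; [apply pow_le; lra|].
    apply pow_incr; assumption. }
  assert (Hln : 14 * ln a <= 5 * (ln K + ln d + ln l) + 9 * ln s).
  { apply ln_le in H14; [|apply pow_lt; lra].
    rewrite ln_mult in H14 by (apply pow_lt; try assumption; apply Rmult_lt_0_compat; lra).
    rewrite !ln_pow in H14 by (try assumption; try lra; apply Rmult_lt_0_compat; lra).
    rewrite !ln_mult in H14 by lra.
    cbn [INR] in H14. lra. }
  apply Rle_ge. unfold Rdiv, Rpower. rewrite <- exp_Ropp.
  rewrite <- (exp_ln s Hs), <- !exp_plus.
  (* The factor |A|^(-eps) is at most 1; the comparison of exponents is then [Hln] divided by 9. *)
  assert (0 <= eps * ln a) by (apply Rmult_le_pos; lra).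
  match goal with |- exp ?x <= exp ?y => destruct (Rle_lt_or_eq_dec x y) as [Hlt|Heq] end.
  - lra.
  - left. apply exp_increasing. exact Hlt.
  - rewrite Heq. apply Rle_refl.
Qed.
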